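(* Let $B\subset\mathbb{R}^4$ be an open set, let $f=(f^4,f^5,f^6,f^7):B\to T^4$ be a smooth map, let $X=B\times T^4$ carry the flat metric and the standard $\mathrm{Spin}(7)$-structure $\Phi$, and let $$F^S_\nabla=\sqrt{-1}\sum_{i=0}^3\sum_{a=4}^7\frac{\partial f^a}{\partial x^i}\,dx^i\wedge dy^a$$ be the curvature of the real Fourier--Mukai transform of the graph of $f$. Then, at every point of $X$, $$\Big(1+\tfrac12\langle(F^S_\nabla)^2,\Phi\rangle+\tfrac1{24}*(F^S_\nabla)^4\Big)^2+4\Big|\pi^2_7\Big(F^S_\nabla+\tfrac16*(F^S_\nabla)^3\Big)\Big|^2+2\Big|\pi^4_7\big((F^S_\nabla)^2\big)\Big|^2=\det\Big(\mathrm{id}_{TX}+(-\sqrt{-1}F^S_\nabla)^\sharp\Big),$$ where $(-\sqrt{-1}F^S_\nabla)^\sharp$ is the skew-symmetric endomorphism of $TX$ defined by $\langle(-\sqrt{-1}F^S_\nabla)^\sharp u,v\rangle=-\sqrt{-1}F^S_\nabla(u,v)$ for $u,v\in TX$.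
   Context: Notation: $e^{i_1\cdots i_k}=e^{i_1}\wedge\cdots\wedge e^{i_k}$; powers of forms are wedge powers; $i(\cdot)$ is the interior product; $\alpha^\sharp$ is the metric dual of a 1-form $\alpha$. Setting: $T^4=\mathbb{R}^4/(2\pi\mathbb{Z})^4$. Coordinates on $B$ are $(x^0,x^1,x^2,x^3)$ and on $T^4$ are $(y^4,y^5,y^6,y^7)$. $X=B\times T^4$ has the flat product metric $\langle\cdot,\cdot\rangle=\sum (dx^i)^2+\sum (dy^a)^2$. Set $(e^0,\dots,e^7)=(dx^0,\dots,dx^3,dy^4,\dots,dy^7)$, a positively oriented orthonormal coframe; $*$ is the Hodge star on $X$. Put $\varphi=e^{123}+e^{145}+e^{167}+e^{246}-e^{257}-e^{347}-e^{356}$ and $*_7\varphi=e^{4567}+e^{2367}+e^{2345}+e^{1357}-e^{1346}-e^{1256}-e^{1247}$. The standard $\mathrm{Spin}(7)$-structure is $\Phi=e^0\wedge\varphi+*_7\varphi$. Inner products on $k$-forms are those for which the $e^{i_1\cdots i_k}$ ($i_1<\cdots<i_k$) are orthonormal; for a purely imaginary form, $|\sqrt{-1}\alpha|=|\alpha|$ with $\alpha$ real. Projections: $\pi^k_\ell$ is the orthogonal projection (extended complex linearly) from $\Lambda^kT^*X$ onto the subbundle corresponding to the $\ell$-dimensional irreducible $\mathrm{Spin}(7)$-representation, where $\Lambda^2\cong W_7\oplus W_{21}$ and $\Lambda^4\cong W_1\oplus W_7\oplus W_{27}\oplus W_{35}$. Explicitly $\Lambda^2_7=\{\alpha\mid \Phi\wedge\alpha=3*\alpha\}$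 (so $\pi^2_7(\alpha)=\frac14(\alpha+*(\Phi\wedge\alpha))$) and $\Lambda^4_7=\{e^0\wedge i(\alpha^\sharp)*_7\varphi-\alpha\wedge\varphi\mid \alpha\in\mathrm{span}(e^1,\dots,e^7)\}$. The real Fourier--Mukai transform of the graph of $f$ is the Hermitian connection $d+\sqrt{-1}\sum_{a=4}^7f^ady^a$ of the trivial complex line bundle over $B\times(T^4)^*\cong X$. (The components $f^a$ are defined modulo $2\pi$, so their derivatives are well-defined functions on $B$.) *)

(* Defs.v *)
From HB Require Import structures.
From mathcomp Require Import all_boot all_order all_algebra.
From mathcomp Require Import generic_quotient ring_quotient complex ring lra.
From mathcomp Require Import all_classical all_reals all_analysis.
Set Implicit Arguments.
Unset Strict Implicit.
Unset Printing Implicit Defensive.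
Import Order.TTheory GRing.Theory Num.Theory.
Import numFieldNormedType.Exports.
Import Quotient.Exports.
Local Open Scope classical_set_scope.
Local Open Scope complex_scope.
Local Open Scope quotient_scope.
Local Open Scope ring_scope.

(* The flat metric, the Spin(7)-form and the coframe e^0, ..., e^7 of
   X = B x T^4 are translation invariant, so the fibre of the exterior algebra
   of T^*X (tensored with K) at any point is the exterior algebra of K^8:
   [w I] is the coefficient of w on e^I = e^{i_1} /\ ... /\ e^{i_k}, where
   I = {i_1 < ... < i_k}.  The codomain is K^o to get the K-module structure;
   the pointwise product of {ffun _ -> _} is never used. *)
Definition ext_form (K : comNzRingType) := {ffun {set 'I_8} -> K^o}.

Section Exterior.
Variable K : comNzRingType.
Implicit Types (a b w : ext_form K) (u v : 'cV[K]_8) (I J : {set 'I_8}).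

Definition homog k w := forall I, #|I| != k -> w I = 0.

(* For disjoint I and J, e^I /\ e^J = shuffle_sign I J * e^{I u J}. *)
Definition shuffle_sign I J : K :=
  (-1) ^+ #|[set p : 'I_8 * 'I_8 |
               [&& p.1 \in I, p.2 \in J & (p.2 < p.1)%N]]%SET|.

Definition wedge a b : ext_form K :=
  [ffun I : {set 'I_8} => \sum_(J : {set 'I_8} | J \subset I)
               shuffle_sign J (I :\: J) * a J * b (I :\: J)].

Definition form1 : ext_form K :=
  [ffun I : {set 'I_8} => (I == finset.set0)%:R].

Definition wpow w n : ext_form K := iter n (wedge w) form1.

Definition cov (i : 'I_8) : ext_form K :=
  [ffun I : {set 'I_8} => (I == [set i]%SET)%:R].

(* e^{i_1 ... i_k} for s = [:: i_1; ...; i_k] *)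
Definition e_ (s : seq nat) : ext_form K :=
  foldr (fun i w => wedge (cov (inord i)) w) form1 s.

(* *(e^I) = shuffle_sign I I^c * e^{I^c}, K-linearly extended; the orientation
   is e^{01234567} *)
Definition star w : ext_form K :=
  [ffun I : {set 'I_8} => shuffle_sign (~: I)%SET I * w (~: I)%SET].

(* The inner product for which the e^I are orthonormal, K-bilinear. *)
Definition dotf a b : K := \sum_(I : {set 'I_8}) a I * b I.

(* the scalar underlying a 0-form *)
Definition scal w : K := w finset.set0.

Definition interior v w : ext_form K :=
  [ffun I : {set 'I_8} => \sum_(j : 'I_8 | j \notin I)
               shuffle_sign [set j]%SET I * v j 0 * w (j |: I)%SET].

(* the metric dual of a 1-form, in the frame dual to e^0, ..., e^7 *)
Definition sharp1 w : 'cV[K]_8 := \col_j w [set j]%SET.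

Definition dotv u v : K := \sum_j u j 0 * v j 0.

(* w(u, v) for a 2-form w; e^i /\ e^j (u, v) = u_i v_j - u_j v_i *)
Definition eval2 w u v : K := scal (interior v (interior u w)).

(* w^sharp for a 2-form w, acting on column vectors; see sharp2P *)
Definition sharp2 w : 'M[K]_8 :=
  \matrix_(i, j) eval2 w (delta_mx j 0) (delta_mx i 0).

Definition phi : ext_form K :=
  e_ [:: 1; 2; 3]%N + e_ [:: 1; 4; 5]%N + e_ [:: 1; 6; 7]%N + e_ [:: 2; 4; 6]%N
  - e_ [:: 2; 5; 7]%N - e_ [:: 3; 4; 7]%N - e_ [:: 3; 5; 6]%N.

Definition star7phi : ext_form K :=
  e_ [:: 4; 5; 6; 7]%N + e_ [:: 2; 3; 6; 7]%N + e_ [:: 2; 3; 4; 5]%N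
  + e_ [:: 1; 3; 5; 7]%N - e_ [:: 1; 3; 4; 6]%N - e_ [:: 1; 2; 5; 6]%N
  - e_ [:: 1; 2; 4; 7]%N.

Definition Phi : ext_form K := wedge (cov ord0) phi + star7phi.

Lemma sharp2P w u v : dotv (sharp2 w *m u) v = eval2 w u v.
Proof.
have H u' v' : eval2 w u' v' = \sum_i \sum_j
   (if i == j then 0 else
    shuffle_sign [set i]%SET finset.set0 * shuffle_sign [set j]%SET [set i]%SET *
      w (j |: [set i])%SET) * u' j 0 * v' i 0.
  rewrite /eval2 /scal /interior ffunE.
  apply: eq_big => [i|i _]; first by rewrite finset.in_set0.
  rewrite ffunE big_mkcond mulr_sumr; apply: eq_bigr => j _.
  rewrite finset.setU0 !inE eq_sym; case: eqP => _ /=; last ring.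
  by rewrite !mul0r mulr0.
have delta_sum (k : 'I_8) (F : 'I_8 -> K) :
    \sum_j F j * (delta_mx k 0 : 'cV[K]_8) j 0 = F k.
  rewrite (bigD1 k) //= big1 ?addr0 ?mxE ?eqxx ?mulr1 // => j jk.
  by rewrite mxE (negPf jk) mulr0.
rewrite H /dotv; apply: eq_bigr => i _.
rewrite mxE mulr_suml; apply: eq_bigr => j _; rewrite mxE H.
congr (_ * _ * _).
under eq_bigr do rewrite -mulr_suml delta_sum.
by rewrite delta_sum.
Qed.

End Exterior.

Section Projections.
Variable R : realType.
Implicit Types (w p : ext_form R).

Definition toC w : ext_form R[i] := [ffun I : {set 'I_8} => (w I)%:C].
Definition reform (w : ext_form R[i]) : ext_form R :=
  [ffun I : {set 'I_8} => complex.Re (w I)].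
Definition imform (w : ext_form R[i]) : ext_form R :=
  [ffun I : {set 'I_8} => complex.Im (w I)].

(* |w|^2; in particular |sqrt(-1) a| = |a| for a real *)
Definition normsq (w : ext_form R[i]) : R :=
  dotf (reform w) (reform w) + dotf (imform w) (imform w).

Definition is_orthproj (U : set (ext_form R)) w p :=
  U p /\ forall u, U u -> dotf (w - p) u = 0.

(* The orthogonal projection onto a linear subspace U of the real exterior
   algebra: by finite dimensionality there is exactly one p as required (see
   orthprojE for uniqueness). *)
Definition orthproj (U : set (ext_form R)) w : ext_form R :=
  xget 0 [set p | is_orthproj U w p].

Definition orthprojC (U : set (ext_form R)) (w : ext_form R[i]) :
    ext_form R[i] :=
  toC (orthproj U (reform w)) + 'i%C *: toC (orthproj U (imform w)).

Definition Lambda27 : set (ext_form R) :=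
  [set w | homog 2 w /\ wedge (Phi R) w = 3 *: star w].

(* [lift ord0 j] ranges over the indices 1, ..., 7. *)
Definition Lambda47 : set (ext_form R) :=
  [set w | exists c : 'I_7 -> R,
     let al := \sum_j c j *: cov R (lift ord0 j) in
     w = wedge (cov R ord0) (interior (sharp1 al) (star7phi R))
         - wedge al (phi R)].

Definition pi27 := orthprojC Lambda27.
Definition pi47 := orthprojC Lambda47.

Lemma orthprojE (U : set (ext_form R)) w p :
  (forall u v, U u -> U v -> U (u - v)) -> is_orthproj U w p ->
  orthproj U w = p.
Proof.
move=> UB [Up wp]; apply: xget_unique => // q [Uq wq].
have Uqp := UB _ _ Uq Up.
have : dotf (q - p) (q - p) = 0.
  have : dotf (w - p) (q - p) - dotf (w - q) (q - p) = 0.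
    by rewrite wp // wq // subr0.
  move=> <-; rewrite /dotf -sumrB; apply: eq_bigr => I _.
  by rewrite -mulrBl !ffunE; congr (_ * _); ring.
move/eqP; rewrite psumr_eq0 => [|I _]; last by rewrite -expr2 sqr_ge0.
move=> /allP qp0; apply/ffunP => I; apply/eqP; rewrite -subr_eq0.
have := qp0 I (mem_index_enum _).
by rewrite mulf_eq0 orbb !ffunE.
Qed.

End Projections.

Section Torus.
Variable R : realType.

(* (2 pi Z)^4 *)
Definition lattice : {pred 'rV[R]_4} :=
  [pred v : 'rV[R]_4 | [forall a, v 0 a / (2 * pi) \is a Num.int]].

Fact lattice_zmod_closed : zmod_closed lattice.
Proof.
split=> [|u v]; rewrite !inE; first by apply/forallP => a; rewrite mxE mul0r.
move=> /forallP uP /forallP vP; apply/forallP => a.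
by rewrite !mxE mulrBl rpredB.
Qed.
HB.instance Definition _ :=
  GRing.isZmodClosed.Build 'rV[R]_4 lattice lattice_zmod_closed.

(* T^4 = R^4 / (2 pi Z)^4 *)
Definition torus := Quotient.quot lattice.

Definition torus_proj (v : 'rV[R]_4) : torus := \pi_(torus) v.

Lemma torus_projE (u v : 'rV[R]_4) :
  torus_proj u = torus_proj v <->
  exists k : 'I_4 -> int, forall a, u 0 a - v 0 a = 2 * pi * (k a)%:~R.
Proof.
have pi0 : (2 * pi : R) != 0 by rewrite mulf_neq0 // gt_eqF // pi_gt0.
have -> : torus_proj u = torus_proj v <-> u - v \in lattice.
  rewrite /torus_proj Quotient.idealrBE.
  by split=> [/eqP|/eqP].
split=> [/forallP uv|[k uvk]].
  have H a : exists k : int, u 0 a - v 0 a = 2 * pi * k%:~R.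
    have := uv a; rewrite !mxE => /intrP[k kE]; exists k.
    by rewrite -kE mulrC divfK.
  by have [k kP] := choice H; exists k.
apply/forallP => a; rewrite !mxE uvk mulrC mulKf //.
Qed.

Definition dir (i : 'I_4) : 'rV[R]_4 := delta_mx 0 i.

Fixpoint Ck (k : nat) (V : set 'rV[R]_4) (g : 'rV[R]_4 -> R) : Prop :=
  (forall x, V x -> {for x, continuous g}) /\
  if k is k'.+1 then
    forall i, (forall x, V x -> derivable g x (dir i)) /\ Ck k' V ('D_(dir i) g)
  else True.

Definition smooth_on (V : set 'rV[R]_4) (g : 'rV[R]_4 -> 'rV[R]_4) :=
  forall k a, Ck k V (fun z => g z 0 a).

Implicit Types f : 'rV[R]_4 -> torus.

Definition local_lift f (x : 'rV[R]_4) (g : 'rV[R]_4 -> 'rV[R]_4) :=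
  exists2 V, open_nbhs x V &
    smooth_on V g /\ forall z, V z -> f z = torus_proj (g z).

(* Smoothness on the open set B of a map to T^4; f outside B is irrelevant. *)
Definition smooth_torus_map (B : set 'rV[R]_4) f :=
  forall x, B x -> exists g, local_lift f x g.

(* d f^{4+a} / d x^i, computed in a smooth local lift of f; by partialE the
   choice of the lift is irrelevant. *)
Definition partial f (a i : 'I_4) (x : 'rV[R]_4) : R :=
  'D_(dir i) (fun z => xget (fun=> 0) [set g | local_lift f x g] z 0 a) x.

Lemma partialE f a i x g :
  local_lift f x g -> partial f a i x = 'D_(dir i) (fun z => g z 0 a) x.
Proof.
rewrite /partial => gP; set h := xget _ _.
have : local_lift f x h by by apply: xgetPex; exists g.
case: gP => V [oV Vx] [gs fg] [W [oW Wx] [hs fh]].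
pose d z := h z 0 a - g z 0 a.
have dE z : V z -> W z -> exists k : int, d z = 2 * pi * k%:~R.
  move=> Vz Wz; have : torus_proj (h z) = torus_proj (g z) by rewrite -fg -?fh.
  by move=> /torus_projE[k kE]; exists (k a); rewrite -kE.
have dc : {for x, continuous d}.
  have [hc _] := hs 0%N a; have [gc _] := gs 0%N a.
  exact: (continuousB (hc x Wx) (gc x Vx)).
have nV : \forall z \near x, V z by exact: open_nbhs_nbhs.
have nW : \forall z \near x, W z by exact: open_nbhs_nbhs.
have hg : \forall z \near x, h z 0 a = g z 0 a + d x.
  have nd : \forall z \near x, `|d x - d z| < 1.
    by move/cvgrPdist_lt : dc; apply.
  near=> z.
  have [k kE] : exists k : int, d x = 2 * pi * k%:~R by exact: dE.
  have [l lE] : exists k : int, d z = 2 * pi * k%:~R.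
    by apply: dE; [near: z | near: z].
  have : `|d x - d z| < 1 by near: z.
  rewrite kE lE -mulrBr -intrB normrM.
  have [->|kl] := eqVneq k l; first by move=> _; rewrite -lE /d [RHS]addrC subrK.
  have pi2 : 2 <= pi :> R by exact: pi_ge2.
  move=> /lt_geF/negP[]; rewrite -[leLHS]mulr1 ler_pM //.
    by rewrite ger0_norm; lra.
  by apply: norm_intr_ge1; [exact: intr_int | rewrite intr_eq0 subr_eq0].
rewrite (@near_eq_derive _ _ _ _ (fun z => g z 0 a + d x) x (dir i) hg).
have [_ /(_ i)[gd _]] := gs 1%N a.
by rewrite deriveD ?derive_cst ?addr0 //; exact: gd.
Unshelve. all: by end_near.
Qed.

Definition dx (i : 'I_4) : ext_form R[i] := cov R[i] (lshift 4 i).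
Definition dy (a : 'I_4) : ext_form R[i] := cov R[i] (rshift 4 a).

(* The curvature of d + sqrt(-1) \sum_a f^a dy^a at a point of X = B x T^4. *)
Definition curvature f (p : 'rV[R]_4 * torus) : ext_form R[i] :=
  'i%C *: \sum_(i < 4) \sum_(a < 4)
          (partial f a i p.1)%:C *: wedge (dx i) (dy a).

Lemma curvature_imaginary f p :
  toC (reform (- 'i%C *: curvature f p)) = - 'i%C *: curvature f p.
Proof.
rewrite /curvature; set G := \sum_i _.
have -> : G = toC [ffun I => \sum_(i < 4) \sum_(a < 4)
    partial f a i p.1 * wedge (cov R (lshift 4 i)) (cov R (rshift 4 a)) I].
  apply/ffunP => I; rewrite sum_ffunE !ffunE rmorph_sum; apply: eq_bigr => j _.
  rewrite sum_ffunE rmorph_sum; apply: eq_bigr => a _.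
  rewrite [LHS]ffunE rmorphM; congr (_ * _).
  rewrite !ffunE rmorph_sum; apply: eq_bigr => J _.
  by rewrite !ffunE !rmorphM rmorphXn rmorphN1 !rmorph_nat.
apply/ffunP => I; rewrite scalerA !ffunE.
by apply/eqP; rewrite eq_complex /=; simpc.
Qed.

End Torus.

(* Main.v *)
(* Every quantity in the identity is determined by the 16 partial derivatives
   of f at x, and the identity becomes an equality of polynomials in 16
   variables.  The projections are made explicit by orthogonal bases: for a
   2-form u, u + *(Phi /\ u) = 4 pi^2_7(u) = sum_k <u, b_k> b_k, where the
   b_k = e^{0k} + *(Phi /\ e^{0k}), k = 1, ..., 7, are pairwise orthogonal of
   squared norm 4, and the forms e^0 /\ i(e_k) *_7 phi - e^k /\ phi that span
   Lambda^4_7 are pairwise orthogonal of squared norm 8.  Forms with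
   polynomial coefficients are represented by lists of signed monomials on
   which wedge, star, interior and inner product compute, so that the
   remaining identities are decided by comparing normal forms. *)
From Stdlib Require Import ZArith.
Require Import Defs.
From mathcomp Require Import all_boot all_order all_algebra.
From mathcomp Require Import all_classical all_reals all_analysis.
From mathcomp Require Import complex.
From mathcomp Require Import ring lra ssrZ.
Set Implicit Arguments.
Unset Strict Implicit.
Unset Printing Implicit Defensive.
Import Order.TTheory GRing.Theory Num.Theory.
Import numFieldNormedType.Exports.
Local Open Scope complex_scope.
Local Open Scope ring_scope.

(** * Multilinearity of the exterior operations and their values on the basis *)

Section ExteriorBasis.
Variable K : comNzRingType.
Implicit Types (a b w : ext_form K) (I J : {set 'I_8}) (c : K).

(** The basis form e^I. By definition it is [form1] at the empty set and [cov K j] at the singleton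
    of j. *)
Definition eform I : ext_form K := [ffun J : {set 'I_8} => (J == I)%:R].

Lemma eform_decomp w : w = \sum_I w I *: eform I.
Proof.
apply/ffunP => J; rewrite sum_ffunE (bigD1 J) //= big1 => [|I IJ].
  by rewrite !ffunE eqxx addr0 /GRing.scale /= mulr1.
by rewrite !ffunE eq_sym (negPf IJ) /GRing.scale /= mulr0.
Qed.

Lemma wedgeDl a b w : wedge (a + b) w = wedge a w + wedge b w.
Proof.
apply/ffunP => I; rewrite !ffunE -big_split; apply: eq_bigr => J _ /=.
by rewrite ffunE mulrDr mulrDl.
Qed.

Lemma wedgeDr a b w : wedge w (a + b) = wedge w a + wedge w b.
Proof.
apply/ffunP => I; rewrite !ffunE -big_split; apply: eq_bigr => J _ /=.
by rewrite ffunE mulrDr.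
Qed.

Lemma wedgeZl c a w : wedge (c *: a) w = c *: wedge a w.
Proof.
apply/ffunP => I; rewrite !ffunE scaler_sumr; apply: eq_bigr => J _ /=.
by rewrite ffunE /GRing.scale /=; ring.
Qed.

Lemma wedgeZr c a w : wedge w (c *: a) = c *: wedge w a.
Proof.
apply/ffunP => I; rewrite !ffunE scaler_sumr; apply: eq_bigr => J _ /=.
by rewrite ffunE /GRing.scale /=; ring.
Qed.

Lemma wedge_suml (T : Type) (r : seq T) (F : T -> ext_form K) w :
  wedge (\sum_(i <- r) F i) w = \sum_(i <- r) wedge (F i) w.
Proof.
apply: (big_morph (fun a => wedge a w)) => [a b|]; first exact: wedgeDl.
by rewrite -(scale0r 0) wedgeZl !scale0r.
Qed.

Lemma wedge_sumr (T : Type) (r : seq T) (F : T -> ext_form K) w :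
  wedge w (\sum_(i <- r) F i) = \sum_(i <- r) wedge w (F i).
Proof.
apply: (big_morph (wedge w)) => [a b|]; first exact: wedgeDr.
by rewrite -(scale0r 0) wedgeZr !scale0r.
Qed.

Lemma starD a b : star (a + b) = star a + star b.
Proof. by apply/ffunP => I; rewrite !ffunE mulrDr. Qed.

Lemma starZ c a : star (c *: a) = c *: star a.
Proof. by apply/ffunP => I; rewrite !ffunE /GRing.scale /= mulrCA. Qed.

Lemma star_sum (T : Type) (r : seq T) (F : T -> ext_form K) :
  star (\sum_(i <- r) F i) = \sum_(i <- r) star (F i).
Proof.
apply: (big_morph (@star K)) => [a b|]; first exact: starD.
by rewrite -(scale0r 0) starZ !scale0r.
Qed.

Lemma dotfC a b : dotf a b = dotf b a.
Proof. by apply: eq_bigr => I _; rewrite mulrC. Qed.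

Lemma dotfDl a b w : dotf (a + b) w = dotf a w + dotf b w.
Proof. by rewrite -big_split; apply: eq_bigr => I _; rewrite ffunE mulrDl. Qed.

Lemma dotfZl c a w : dotf (c *: a) w = c * dotf a w.
Proof.
by rewrite mulr_sumr; apply: eq_bigr => I _; rewrite ffunE -mulrA.
Qed.

Lemma dotf_suml (T : Type) (r : seq T) (F : T -> ext_form K) w :
  dotf (\sum_(i <- r) F i) w = \sum_(i <- r) dotf (F i) w.
Proof.
apply: (big_morph (fun a => dotf a w)) => [a b|]; first exact: dotfDl.
by rewrite -(scale0r 0) dotfZl mul0r.
Qed.

Lemma dotf_sumr (T : Type) (r : seq T) (F : T -> ext_form K) w :
  dotf w (\sum_(i <- r) F i) = \sum_(i <- r) dotf w (F i).
Proof. by rewrite dotfC dotf_suml; apply: eq_bigr => i _; rewrite dotfC. Qed.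

Lemma dotfZr c a w : dotf w (c *: a) = c * dotf w a.
Proof. by rewrite dotfC dotfZl dotfC. Qed.

Lemma interior_sharpDl a b w :
  Defs.interior (sharp1 (a + b)) w
  = Defs.interior (sharp1 a) w + Defs.interior (sharp1 b) w.
Proof.
apply/ffunP => I; rewrite !ffunE -big_split; apply: eq_bigr => J _ /=.
by rewrite !mxE !ffunE mulrDr mulrDl.
Qed.

Lemma interior_sharpZl c a w :
  Defs.interior (sharp1 (c *: a)) w = c *: Defs.interior (sharp1 a) w.
Proof.
apply/ffunP => I; rewrite !ffunE scaler_sumr; apply: eq_bigr => J _ /=.
by rewrite !mxE !ffunE /GRing.scale /=; ring.
Qed.

Lemma interior_sharp_suml (T : Type) (r : seq T) (F : T -> ext_form K) w :
  Defs.interior (sharp1 (\sum_(i <- r) F i)) w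
  = \sum_(i <- r) Defs.interior (sharp1 (F i)) w.
Proof.
apply: (big_morph (fun a => Defs.interior (sharp1 a) w)) => [a b|].
  exact: interior_sharpDl.
by rewrite -(scale0r 0) interior_sharpZl !scale0r.
Qed.

Lemma interiorDr u a b :
  Defs.interior u (a + b) = Defs.interior u a + Defs.interior u b.
Proof.
apply/ffunP => I; rewrite !ffunE -big_split; apply: eq_bigr => J _ /=.
by rewrite ffunE mulrDr.
Qed.

Lemma interiorZr c u a : Defs.interior u (c *: a) = c *: Defs.interior u a.
Proof.
apply/ffunP => I; rewrite !ffunE scaler_sumr; apply: eq_bigr => J _ /=.
by rewrite ffunE /GRing.scale /=; ring.
Qed.

Lemma interior_sumr u (T : Type) (r : seq T) (F : T -> ext_form K) :
  Defs.interior u (\sum_(i <- r) F i) = \sum_(i <- r) Defs.interior u (F i).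
Proof.
apply: (big_morph (Defs.interior u)) => [a b|]; first exact: interiorDr.
by rewrite -(scale0r 0) interiorZr !scale0r.
Qed.

(** In the coefficient on e^X only the summand at I survives, and it is nonzero only if I lies in X
    and X minus I is J, that is, if X is the disjoint union of I and J. *)
Lemma wedge_eform I J :
  wedge (eform I) (eform J)
  = (if [disjoint I & J] then shuffle_sign K I J else 0) *: eform (I :|: J)%SET.
Proof.
apply/ffunP => X; rewrite !ffunE (bigID (pred1 I)) /= addrC.
rewrite big1 ?add0r; last first.
  by move=> L /andP[_ /negPf LI]; rewrite ffunE LI mulr0 mul0r.
rewrite (eq_bigl (fun L => (L == I) && (I \subset X))); last first.
  by move=> L; rewrite andbC; case: eqP => // ->.
rewrite big_mkcondr big_pred1_eq /= !ffunE eqxx mulr1 /GRing.scale /=.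
have [->|XIJ] := eqVneq X (I :|: J)%SET.
  rewrite finset.subsetUl finset.setDUl finset.setDv finset.set0U mulr1.
  have [/finset.setDidPl IJ|nIJ] := boolP [disjoint I & J].
    by rewrite (_ : (J :\: I = J)%SET) ?eqxx ?mulr1 //;
      apply/finset.setDidPl; rewrite disjoint_sym; apply/finset.setDidPl.
  rewrite (_ : (_ == _) = false) ?mulr0 //; apply/negbTE.
  by apply: contra nIJ => /eqP/finset.setDidPl; rewrite disjoint_sym.
rewrite mulr0; case: ifP => // IX.
rewrite (_ : (_ == _) = false) ?mulr0 //; apply/negbTE.
apply: contra XIJ => /eqP <-; rewrite finset.setDE finset.setUIr finset.setUCr.
by rewrite finset.setIT; apply/eqP/esym/finset.setUidPr.
Qed.

Lemma star_eform I :
  star (eform I) = shuffle_sign K I (~: I)%SET *: eform (~: I)%SET.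
Proof.
apply/ffunP => X; rewrite !ffunE /GRing.scale /=.
have -> : (~: X == I)%SET = (X == ~: I)%SET.
  by rewrite -(inj_eq (@finset.setC_inj _)) finset.setCK.
by case: eqP => [->|_]; rewrite ?mulr0 // finset.setCK.
Qed.

Lemma interior_eform j I :
  Defs.interior (sharp1 (cov K j)) (eform I)
  = (if j \in I then shuffle_sign K [set j] (I :\ j) else 0)%SET
    *: eform (I :\ j)%SET.
Proof.
apply/ffunP => X; rewrite !ffunE /GRing.scale /=.
rewrite (bigID (pred1 j)) /= addrC big1 ?add0r; last first.
  move=> k /andP[_ /negPf kj]; rewrite !mxE !ffunE.
  by rewrite (inj_eq finset.set1_inj) kj mulr0 mul0r.
rewrite (eq_bigl (fun k => (k == j) && (j \notin X))); last first.
  by move=> k; rewrite andbC; case: eqP => // ->.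
rewrite big_mkcondr big_pred1_eq /= !mxE !ffunE eqxx mulr1.
have [->|XI] := eqVneq X (I :\ j)%SET.
  rewrite !inE eqxx /= mulr1; case: ifP => jI.
    by rewrite finset.setD1K // eqxx mulr1.
  rewrite (_ : (_ == _) = false) ?mulr0 //; apply/negbTE.
  by apply/eqP => /finset.setP/(_ j); rewrite !inE eqxx jI.
rewrite mulr0; case: ifP => // jX.
rewrite (_ : (_ == _) = false) ?mulr0 //; apply/negbTE.
by apply: contra XI => /eqP <-; rewrite finset.setU1K.
Qed.

Lemma dotf_eform I J : dotf (eform I) (eform J) = (I == J)%:R.
Proof.
rewrite /dotf (bigD1 I) //= big1 => [|L /negPf LI].
  by rewrite !ffunE eqxx mul1r addr0.
by rewrite !ffunE LI mul0r.
Qed.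

End ExteriorBasis.

(** * Computing with linear combinations of basis elements *)

Fixpoint lexle (s t : seq nat) : bool :=
  match s, t with
  | [::], _ => true
  | _, [::] => false
  | x :: s', y :: t' => if x == y then lexle s' t' else (x < y)%N
  end.

Section Collect.
Variables (T : eqType) (enc : T -> seq nat).
Implicit Types (l : seq (T * Z)) (t : T * Z).

Definition push t l :=
  if l is u :: l' then
    if t.1 == u.1 then
      let c := Z.add t.2 u.2 in if Z.eqb c 0 then l' else (t.1, c) :: l'
    else t :: l
  else [:: t].

(** Sorting by the code of the key brings equal keys together, so that [push] need only merge
    neighbours; zero coefficients are dropped before and after merging. *)
Definition collect l :=
  foldr push [::] (sort (fun s t => lexle (enc s.1) (enc t.1))
                     [seq t <- l | ~~ Z.eqb t.2 0]).

Definition lscale (c : Z) l := [seq (t.1, Z.mul c t.2) | t <- l].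

Variables (K : comNzRingType) (V : lmodType K) (b : T -> V).

Definition zval (c : Z) : K := (int_of_Z c)%:~R.

Lemma zvalD : {morph zval : c d / Z.add c d >-> c + d}.
Proof. by move=> c d; rewrite /zval [int_of_Z _]raddfD intrD. Qed.

Lemma zvalM : {morph zval : c d / Z.mul c d >-> c * d}.
Proof. by move=> c d; rewrite /zval [int_of_Z _]rmorphM intrM. Qed.

Definition lcomb l : V := \sum_(t <- l) zval t.2 *: b t.1.

Lemma lcomb_cat l1 l2 : lcomb (l1 ++ l2) = lcomb l1 + lcomb l2.
Proof. exact: big_cat. Qed.

Lemma lcomb_scale c l : lcomb (lscale c l) = zval c *: lcomb l.
Proof.
rewrite /lcomb big_map scaler_sumr; apply: eq_bigr => t _ /=.
by rewrite zvalM scalerA.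
Qed.

Lemma lcomb_push t l : lcomb (push t l) = zval t.2 *: b t.1 + lcomb l.
Proof.
case: l => [|u l] /=; first by rewrite /lcomb big_seq1 big_nil addr0.
case: eqP => [tu|_]; last by rewrite /lcomb big_cons.
rewrite /lcomb big_cons -tu addrA -scalerDl -zvalD.
by case: Z.eqb_spec => [->|_]; rewrite ?big_cons // scale0r add0r.
Qed.

Lemma lcomb_collect l : lcomb (collect l) = lcomb l.
Proof.
rewrite /collect; set le := fun s t => _.
have -> (s : seq (T * Z)) : lcomb (foldr push [::] s) = lcomb s.
  elim: s => [|t s IHs] //=.
  by rewrite lcomb_push IHs /lcomb big_cons.
rewrite /lcomb (perm_big _ (permEl (perm_sort le _))) /= big_filter.
rewrite big_mkcond; apply: eq_bigr => t _.
by case: Z.eqb_spec => [->|_] //=; rewrite scale0r.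
Qed.

(** Normalizing preserves the value, so a computed equality of normal forms is a proof of an
    identity, for every ring and every choice of [b]. *)
Lemma collect_inj l1 l2 : collect l1 = collect l2 -> lcomb l1 = lcomb l2.
Proof. by move=> l12; rewrite -lcomb_collect l12 lcomb_collect. Qed.

End Collect.

(* A monomial is the list of its variables, sorted only so that equal
   monomials are recognized. *)
Definition monom := seq nat.
Definition zpoly := seq (monom * Z).
(* Only the bits 0, ..., 7 of a mask are read, and missing bits are 0, so that
   [::] encodes the empty set. *)
Definition bmask := bitseq.
Definition mform := seq ((bmask * monom) * Z).

Definition pmul (p q : zpoly) : zpoly :=
  [seq (merge leq s.1 t.1, Z.mul s.2 t.2) | s <- p, t <- q].

Definition pcollect (p : zpoly) : zpoly := collect id p.
Definition fcollect (l : mform) : mform :=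
  collect (fun x => map nat_of_bool x.1 ++ x.2) l.

Definition mor (m1 m2 : bmask) : bmask :=
  mkseq (fun i => nth false m1 i || nth false m2 i) 8.
Definition mcompl (m : bmask) : bmask := mkseq (fun i => ~~ nth false m i) 8.
Definition mrem (m : bmask) (j : nat) : bmask :=
  mkseq (fun i => (i != j) && nth false m i) 8.
Definition mdisj (m1 m2 : bmask) : bool :=
  all (fun i => ~~ (nth false m1 i && nth false m2 i)) (iota 0 8).
Definition meqb (m1 m2 : bmask) : bool :=
  all (fun i => nth false m1 i == nth false m2 i) (iota 0 8).

(* The parity of the number of pairs (i, j) in m1 x m2 with j < i. *)
Fixpoint minv (n : nat) (m1 m2 : bmask) : bool :=
  if n is n'.+1 then
    (head false m2 && odd (count id (take n' (behead m1))))
    (+) minv n' (behead m1) (behead m2)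
  else false.

Definition msign (m1 m2 : bmask) : Z :=
  if minv 8 m1 m2 then Z.neg 1 else Z.pos 1.

Definition fwedge (l1 l2 : mform) : mform :=
  [seq ((mor s.1.1 t.1.1, merge leq s.1.2 t.1.2),
        if mdisj s.1.1 t.1.1
        then Z.mul (msign s.1.1 t.1.1) (Z.mul s.2 t.2) else Z0)
  | s <- l1, t <- l2].

Definition fstar (l : mform) : mform :=
  [seq ((mcompl t.1.1, t.1.2), Z.mul (msign t.1.1 (mcompl t.1.1)) t.2)
  | t <- l].

Definition finterior (j : nat) (l : mform) : mform :=
  [seq ((mrem t.1.1 j, t.1.2),
        if nth false t.1.1 j
        then Z.mul (msign (mkseq (fun i => i == j) 8) (mrem t.1.1 j)) t.2
        else Z0)
  | t <- l].

Definition fdot (l1 l2 : mform) : zpoly :=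
  [seq (merge leq s.1.2 t.1.2,
        if meqb s.1.1 t.1.1 then Z.mul s.2 t.2 else Z0)
  | s <- l1, t <- l2].

(** * Bit masks as sets of indices *)

Definition maskset (m : bmask) : {set 'I_8} :=
  [set i : 'I_8 | nth false m i]%SET.

Lemma maskset_mkseq (P : pred nat) :
  maskset (mkseq P 8) = [set i : 'I_8 | P i]%SET.
Proof. by apply/finset.setP => i; rewrite !inE nth_mkseq. Qed.

Lemma maskset_or m1 m2 : maskset (mor m1 m2) = (maskset m1 :|: maskset m2)%SET.
Proof. by rewrite maskset_mkseq; apply/finset.setP => i; rewrite !inE. Qed.

Lemma maskset_compl m : maskset (mcompl m) = (~: maskset m)%SET.
Proof. by rewrite maskset_mkseq; apply/finset.setP => i; rewrite !inE. Qed.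

Lemma maskset_rem m (j : 'I_8) : maskset (mrem m j) = (maskset m :\ j)%SET.
Proof. by rewrite maskset_mkseq; apply/finset.setP => i; rewrite !inE. Qed.

Lemma maskset1 (j : 'I_8) : maskset (mkseq (fun i => i == j) 8) = [set j]%SET.
Proof. by rewrite maskset_mkseq; apply/finset.setP => i; rewrite !inE. Qed.

(** Connects a check over a list of naturals, which can be evaluated, with a statement about
    ordinals. *)
Lemma all_iota_ord n (P : pred nat) :
  reflect (forall i : 'I_n, P i) (all P (iota 0 n)).
Proof.
apply: (iffP allP) => [H i|H i]; first by apply: H; rewrite mem_iota /=.
by rewrite mem_iota /= => ltin; exact: H (Ordinal ltin).
Qed.

Lemma maskset_disj m1 m2 : [disjoint maskset m1 & maskset m2] = mdisj m1 m2.
Proof.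
apply/pred0P/all_iota_ord => H i; first by move: (H i); rewrite !inE => /= ->.
by rewrite /= !inE; exact/negbTE/H.
Qed.

Lemma maskset_eq m1 m2 : (maskset m1 == maskset m2) = meqb m1 m2.
Proof.
apply/eqP/all_iota_ord => [/finset.setP H i|H].
  by apply/eqP; move: (H i); rewrite !inE.
by apply/finset.setP => i; rewrite !inE; exact/eqP/H.
Qed.

(** Induction on n, peeling off index 0: pairs with i = 0 are never inversions, pairs with j = 0 are
    counted by the bits of [m1] beyond the first, and all other pairs belong to the tails. *)
Lemma minvE n m1 m2 :
  minv n m1 m2
  = odd (\sum_(i < n) \sum_(j < n)
           [&& nth false m1 i, nth false m2 j & (j < i)%N]).
Proof.
elim: n m1 m2 => [|n IHn] m1 m2 /=; first by rewrite big_ord0.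
rewrite big_ord_recl [X in odd (X + _)]big1 ?add0n => [|j _]; last first.
  by rewrite ltn0 !andbF.
under eq_bigr do rewrite big_ord_recl /=.
rewrite big_split oddD IHn; congr (_ (+) odd _); last first.
  apply: eq_bigr => i _; apply: eq_bigr => j _ /=.
  by rewrite !nth_behead.
transitivity (odd (head false m2 * count id (take n (behead m1)))).
  by rewrite oddM; case: head.
congr odd; rewrite mulnC -nth0; move: (nth false m2 0) => c.
under eq_bigr do rewrite ltn0Sn andbT /bump /= add1n -nth_behead -mulnb.
rewrite -big_distrl /=; congr (_ * _)%N; move: (behead m1) => {IHn m1} s.
elim: n s => [|n IHn] s; first by rewrite take0 big_ord0.
case: s => [|x s]; first by rewrite big1 // => i _; rewrite nth_nil.
by rewrite big_ord_recl /= IHn.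
Qed.

(** * Values of symbolic polynomials and forms *)

Section Interpretation.
Variables (K : comNzRingType) (v : nat -> K).

(** The codomain [K^o] makes polynomials, like forms, an instance of [lcomb]. *)
Definition meval (x : monom) : K^o := \prod_(i <- x) v i.
Definition peval (p : zpoly) : K := lcomb meval p.
Definition fbasis (x : bmask * monom) : ext_form K :=
  meval x.2 *: eform K (maskset x.1).
Definition feval (l : mform) : ext_form K := lcomb fbasis l.

Lemma meval_merge x y : meval (merge leq x y) = meval x * meval y.
Proof. by rewrite /meval (perm_big _ (permEl (perm_merge _ _ _))) big_cat. Qed.

Lemma zval_msign m1 m2 :
  zval K (msign m1 m2) = shuffle_sign K (maskset m1) (maskset m2).
Proof.
rewrite /shuffle_sign -signr_odd; set n := #|_|.
have -> : odd n = minv 8 m1 m2.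
  rewrite minvE; congr odd; rewrite /n -sum1_card pair_big /=.
  rewrite big_mkcond /=; apply: eq_bigr => -[i j] _ /=.
  by rewrite !inE /=; case: ifP.
rewrite /msign; case: minv => //=; exact: mulN1r.
Qed.

Lemma pevalD p q : peval (p ++ q) = peval p + peval q.
Proof. by rewrite /peval lcomb_cat. Qed.

Lemma pevalZ c p : peval (lscale c p) = zval K c * peval p.
Proof. by rewrite /peval lcomb_scale. Qed.

Lemma pevalM p q : peval (pmul p q) = peval p * peval q.
Proof.
rewrite /peval /lcomb big_allpairs_dep mulr_suml; apply: eq_bigr => s _.
rewrite mulr_sumr; apply: eq_bigr => t _ /=.
by rewrite meval_merge zvalM /GRing.scale /=; ring.
Qed.

Lemma pevalE p q : pcollect p = pcollect q -> peval p = peval q.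
Proof. exact: (@collect_inj _ id K K^o meval). Qed.

Lemma fevalD l1 l2 : feval (l1 ++ l2) = feval l1 + feval l2.
Proof. exact: lcomb_cat. Qed.

Lemma fevalZ c l : feval (lscale c l) = zval K c *: feval l.
Proof. exact: lcomb_scale. Qed.

Lemma fevalE l1 l2 : fcollect l1 = fcollect l2 -> feval l1 = feval l2.
Proof. exact: (collect_inj fbasis). Qed.

Lemma feval_wedge l1 l2 : feval (fwedge l1 l2) = wedge (feval l1) (feval l2).
Proof.
rewrite /feval /lcomb big_allpairs_dep wedge_suml; apply: eq_bigr => s _.
rewrite wedge_sumr; apply: eq_bigr => t _ /=.
rewrite /fbasis /= !wedgeZl !wedgeZr wedge_eform maskset_or maskset_disj.
rewrite meval_merge.
rewrite !scalerA; congr (_ *: _).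
by case: mdisj; rewrite ?zvalM ?zval_msign ?mulr0 ?mul0r //; ring.
Qed.

Lemma feval_star l : feval (fstar l) = star (feval l).
Proof.
rewrite /feval /lcomb big_map star_sum; apply: eq_bigr => s _ /=.
rewrite /fbasis /= !starZ star_eform zvalM zval_msign maskset_compl !scalerA.
by congr (_ *: _); ring.
Qed.

Lemma feval_interior (j : 'I_8) l :
  feval (finterior j l) = Defs.interior (sharp1 (cov K j)) (feval l).
Proof.
rewrite /feval /lcomb big_map interior_sumr; apply: eq_bigr => s _ /=.
rewrite /fbasis /= !interiorZr interior_eform maskset_rem !scalerA.
congr (_ *: _); rewrite inE.
case: nth; rewrite ?zvalM ?zval_msign ?maskset1 ?maskset_rem;
  by rewrite ?mulr0 ?mul0r //; ring.
Qed.

Lemma peval_dot l1 l2 : peval (fdot l1 l2) = dotf (feval l1) (feval l2).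
Proof.
rewrite /feval /peval /lcomb big_allpairs_dep dotf_suml; apply: eq_bigr => s _.
rewrite dotf_sumr; apply: eq_bigr => t _ /=.
rewrite /fbasis /= !dotfZl !dotfZr dotf_eform maskset_eq meval_merge.
rewrite /GRing.scale /=.
by case: meqb => /=; [rewrite zvalM; ring | rewrite !mulr0 [LHS]mul0r].
Qed.

End Interpretation.

(** * Symbolic determinants and the forms of the Spin(7)-structure *)

Definition psum (n : nat) (p : nat -> zpoly) : zpoly :=
  flatten [seq p i | i <- iota 0 n].

Definition fsum (n : nat) (l : nat -> mform) : mform :=
  flatten [seq l i | i <- iota 0 n].

Definition fsmul (p : zpoly) (l : mform) : mform :=
  [seq ((t.1.1, merge leq s.1 t.1.2), Z.mul s.2 t.2) | s <- p, t <- l].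

Definition pconst (c : Z) : zpoly := [:: ([::], c)].
Definition pvar (k : nat) : zpoly := [:: ([:: k], Z.pos 1)].
Definition fbase (m : bmask) : mform := [:: ((m, [::]), Z.pos 1)].
Definition fone : mform := fbase [::].
Definition fcov (i : nat) : mform := fbase (mkseq (fun k => k == i) 8).
Definition fe (s : seq nat) : mform :=
  foldr (fun i => fwedge (fcov i)) fone s.
Definition fopp (l : mform) : mform := lscale (Z.neg 1) l.

(* Zero entries are skipped: this keeps the expansion of a sparse matrix
   short. *)
Fixpoint pdet (n : nat) (M : nat -> nat -> zpoly) : zpoly :=
  if n is n'.+1 then
    psum n (fun j =>
      if M 0%N j is [::] then [::] else
      pmul (lscale (if odd j then Z.neg 1 else Z.pos 1) (M 0%N j))
           (pdet n' (fun i k => M i.+1 (bump j k))))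
  else pconst (Z.pos 1).

Definition fform (s : seq (Z * seq nat)) : mform :=
  flatten [seq lscale c.1 (fe c.2) | c <- s].

Definition fphi : mform := fform
  [:: (Z.pos 1, [:: 1; 2; 3]%N); (Z.pos 1, [:: 1; 4; 5]%N);
      (Z.pos 1, [:: 1; 6; 7]%N); (Z.pos 1, [:: 2; 4; 6]%N);
      (Z.neg 1, [:: 2; 5; 7]%N); (Z.neg 1, [:: 3; 4; 7]%N);
      (Z.neg 1, [:: 3; 5; 6]%N)].

Definition fstar7phi : mform := fform
  [:: (Z.pos 1, [:: 4; 5; 6; 7]%N); (Z.pos 1, [:: 2; 3; 6; 7]%N);
      (Z.pos 1, [:: 2; 3; 4; 5]%N); (Z.pos 1, [:: 1; 3; 5; 7]%N);
      (Z.neg 1, [:: 1; 3; 4; 6]%N); (Z.neg 1, [:: 1; 2; 5; 6]%N);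
      (Z.neg 1, [:: 1; 2; 4; 7]%N)].

Definition fPhi : mform := fcollect (fwedge (fcov 0) fphi ++ fstar7phi).

(* [j] stands for the index j + 1, as [lift ord0 j] does in [Lambda47]. *)
Definition fbasis27 (j : nat) : mform :=
  fcollect (fe [:: 0%N; j.+1] ++ fstar (fwedge fPhi (fe [:: 0%N; j.+1]))).

Definition fbasis47 (j : nat) : mform :=
  fcollect (fwedge (fcov 0) (finterior j.+1 fstar7phi)
            ++ fopp (fwedge (fcov j.+1) fphi)).

Section Evaluation.
Variables (K : comNzRingType) (v : nat -> K).

Lemma big_iota_ord (V : nmodType) n (F : nat -> V) :
  \sum_(i <- iota 0 n) F i = \sum_(i < n) F i.
Proof. by rewrite -(big_mkord xpredT) /index_iota subn0. Qed.

Lemma peval_sum n p : peval v (psum n p) = \sum_(i < n) peval v (p i).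
Proof.
by rewrite /peval /lcomb big_flatten big_map big_iota_ord.
Qed.

Lemma feval_sum n l : feval v (fsum n l) = \sum_(i < n) feval v (l i).
Proof.
by rewrite /feval /lcomb big_flatten big_map big_iota_ord.
Qed.

Lemma feval_smul p l : feval v (fsmul p l) = peval v p *: feval v l.
Proof.
rewrite /feval /peval /lcomb big_allpairs_dep scaler_suml.
apply: eq_bigr => s _; rewrite scaler_sumr; apply: eq_bigr => t _ /=.
rewrite /fbasis /= !scalerA meval_merge zvalM; congr (_ *: _).
by rewrite /GRing.scale /=; ring.
Qed.

Lemma zval1 : zval K (Z.pos 1) = 1. Proof. by []. Qed.

Lemma zvalN1 : zval K (Z.neg 1) = - 1. Proof. by []. Qed.

Lemma peval_const c : peval v (pconst c) = zval K c.
Proof.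
by rewrite /peval /lcomb big_seq1 /meval big_nil /GRing.scale /= mulr1.
Qed.

Lemma peval_var k : peval v (pvar k) = v k.
Proof.
by rewrite /peval /lcomb big_seq1 /meval big_seq1 /GRing.scale /= mul1r.
Qed.

Lemma feval_base m : feval v (fbase m) = eform K (maskset m).
Proof.
by rewrite /feval /lcomb big_seq1 /fbasis /meval big_nil scale1r scale1r.
Qed.

Lemma feval_one : feval v fone = form1 K.
Proof.
rewrite feval_base; congr eform; apply/finset.setP => i.
by rewrite !inE nth_nil.
Qed.

Lemma feval_cov (i : 'I_8) : feval v (fcov i) = cov K i.
Proof. by rewrite feval_base maskset1. Qed.

Lemma feval_fe s : all (fun i => (i < 8)%N) s -> feval v (fe s) = e_ K s.
Proof.
elim: s => [|i s IHs] /=; first by rewrite feval_one.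
case/andP=> i8 /IHs <-; rewrite feval_wedge; congr wedge.
by rewrite -feval_cov inordK.
Qed.

Lemma feval_opp l : feval v (fopp l) = - feval v l.
Proof. by rewrite /fopp fevalZ scaleN1r. Qed.

Lemma feval_collect l : feval v (fcollect l) = feval v l.
Proof. exact: lcomb_collect. Qed.

Lemma peval_collect p : peval v (pcollect p) = peval v p.
Proof. exact: (@lcomb_collect _ id K K^o (meval v)). Qed.

(** Pairing with [form1], the basis form of the empty set, extracts the coefficient there. *)
Lemma scal_feval l : scal (feval v l) = peval v (fdot l fone).
Proof.
rewrite peval_dot feval_one /scal [in LHS](eform_decomp (feval v l)).
rewrite sum_ffunE; apply: eq_bigr => I _; rewrite !ffunE eq_sym.
by [].
Qed.

Lemma pdetE n M :
  peval v (pdet n M) = \det (\matrix_(i < n, j < n) peval v (M i j)).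
Proof.
elim: n M => [|n IHn] M; first by rewrite det_mx00 peval_const.
rewrite [pdet _ _]/= peval_sum (expand_det_row _ ord0); apply: eq_bigr => j _.
rewrite mxE /cofactor.
transitivity (peval v (M 0%N j) *
    ((-1) ^+ j * \det (\matrix_(i < n, k < n) peval v (M i.+1 (bump j k))))).
  (* The empty list evaluates to 0, which justifies the skipping in [pdet]. *)
  case E: (M 0%N j) => [|t p].
    by rewrite /peval /lcomb !big_nil [RHS]mul0r.
  rewrite -E pevalM pevalZ IHn -signr_odd mulrA [zval _ _ * _]mulrC.
  by congr (_ * _ * _); case: odd.
rewrite add0n; congr (_ * (_ * \det _)).
by apply/matrixP => i k; rewrite !mxE.
Qed.

Lemma feval_form s : all (fun c => all (fun i => (i < 8)%N) c.2) s ->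
  feval v (fform s) = \sum_(c <- s) zval K c.1 *: e_ K c.2.
Proof.
move=> /allP s8; rewrite [LHS]/feval /lcomb big_flatten big_map.
rewrite big_seq [RHS]big_seq; apply: eq_bigr => c /s8 c8.
by rewrite -(feval_fe c8) -fevalZ.
Qed.

Lemma feval_phi : feval v fphi = phi K.
Proof.
rewrite feval_form // /phi; move: (e_ K) => e.
by rewrite !big_cons big_nil /= zval1 zvalN1 !scale1r !scaleN1r addr0 !addrA.
Qed.

Lemma feval_star7phi : feval v fstar7phi = star7phi K.
Proof.
rewrite feval_form // /star7phi; move: (e_ K) => e.
by rewrite !big_cons big_nil /= zval1 zvalN1 !scale1r !scaleN1r addr0 !addrA.
Qed.

Lemma feval_Phi : feval v fPhi = Phi K.
Proof.
rewrite feval_collect fevalD feval_wedge feval_phi feval_star7phi.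
by rewrite (feval_cov ord0).
Qed.

Lemma homog_feval k l :
  all (fun t : (bmask * monom) * Z =>
         count (nth false t.1.1) (iota 0 8) == k) l ->
  homog k (feval v l).
Proof.
move=> /allP lk I Ik; rewrite /feval /lcomb sum_ffunE big_seq big1 // => t tl.
rewrite !ffunE (_ : (_ == _) = false) /GRing.scale /= ?mulr0n ?mulr0 //.
apply: contraNF Ik => /eqP ->; rewrite -(eqP (lk _ tl)).
rewrite -sum1_card -sum1_count big_mkcond -[iota 0 8]/(index_iota 0 8).
rewrite [X in _ == X]big_mkcond big_mkord; apply/eqP; apply: eq_bigr => i _.
by rewrite inE.
Qed.

End Evaluation.

(** * Orthogonal bases for the two seven-dimensional projections *)

Lemma fbasis27_homog (K : comNzRingType) (v : nat -> K) (j : 'I_7) :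
  homog 2 (feval v (fbasis27 j)).
Proof.
apply: homog_feval; move: j.
apply/(all_iota_ord 7 (fun j => all _ (fbasis27 j))).
by vm_compute.
Qed.

Lemma fbasis27_eigen (K : comNzRingType) (v : nat -> K) (j : 'I_7) :
  wedge (Phi K) (feval v (fbasis27 j)) = 3 *: star (feval v (fbasis27 j)).
Proof.
rewrite -(feval_Phi v) -feval_wedge -feval_star.
(* With 3 read as the image of an integer, both sides are values of symbolic forms. *)
rewrite -[3]/(zval K (Z.pos 3)) -fevalZ.
apply: fevalE; apply/eqP; move: j.
apply/(all_iota_ord 7 (fun j => fcollect (fwedge fPhi (fbasis27 j)) ==
  fcollect (lscale _ (fstar (fbasis27 j))))).
by vm_compute.
Qed.

Definition gram_ok (N : Z) (b : nat -> mform) : bool :=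
  all (fun i => all (fun j => pcollect (fdot (b i) (b j)) ==
         pcollect (pconst (if i == j then N else Z0))) (iota 0 7)) (iota 0 7).

Lemma gramP (K : comNzRingType) (v : nat -> K) N b (i j : 'I_7) :
  gram_ok N b ->
  dotf (feval v (b i)) (feval v (b j)) = zval K N * (i == j)%:R.
Proof.
move=> /(all_iota_ord 7 (fun i => all _ _))/(_ i).
move=> /(all_iota_ord 7 (fun j => _ == _))/(_ j)/eqP/(pevalE v).
rewrite peval_dot => ->; rewrite peval_const -(inj_eq val_inj) /=.
by case: eqP; rewrite ?mulr1 ?mulr0.
Qed.

Lemma fbasis27_gram : gram_ok (Z.pos 4) fbasis27.
Proof. by vm_compute. Qed.

Lemma fbasis47_gram : gram_ok (Z.pos 8) fbasis47.
Proof. by vm_compute. Qed.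

Definition mpair (i j : nat) : bmask := mkseq (fun k => (k == i) || (k == j)) 8.

Lemma feval_pair (K : comNzRingType) (v : nat -> K) (i j : 'I_8) :
  feval v (fbase (mpair i j)) = eform K [set i; j]%SET.
Proof.
rewrite feval_base; congr eform; rewrite maskset_mkseq.
by apply/finset.setP => k; rewrite !inE.
Qed.

(* By linearity an identity between linear operators on 2-forms need only be
   checked on e^{ij}. *)
Lemma homog2_ind (K : comNzRingType) (L : ext_form K -> ext_form K) u :
  (forall a b, L (a + b) = L a + L b) -> (forall c a, L (c *: a) = c *: L a) ->
  (forall i j : 'I_8, i != j -> L (eform K [set i; j]%SET) = 0) ->
  homog 2 u -> L u = 0.
Proof.
move=> LD LZ Lij u2; rewrite (eform_decomp u).
rewrite (big_morph L (id1 := 0) LD); last by rewrite -(scale0r 0) LZ !scale0r.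
rewrite big1 // => I _; rewrite LZ.
have [/eqP/cards2P[i [j [ij ->]]]|/u2 ->] := eqVneq #|I| 2.
  by rewrite Lij // scaler0.
by rewrite scale0r.
Qed.

Lemma fstarstar_ok :
  all (fun i => all (fun j => (i != j) ==>
    (fcollect (fstar (fstar (fbase (mpair i j))))
     == fcollect (fbase (mpair i j)))) (iota 0 8)) (iota 0 8).
Proof. by vm_compute. Qed.

Lemma fproj27_ok :
  all (fun i => all (fun j => (i != j) ==>
    (fcollect (fbase (mpair i j) ++ fstar (fwedge fPhi (fbase (mpair i j))))
     == fcollect (fsum 7 (fun k =>
          fsmul (fdot (fbase (mpair i j)) (fbasis27 k)) (fbasis27 k)))))
    (iota 0 8)) (iota 0 8).
Proof. by vm_compute. Qed.

(** In dimension 8 the square of the star on k-forms is (-1)^(k(8-k)), which is 1 for k = 2. *)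
Lemma starK2 (K : comNzRingType) (u : ext_form K) :
  homog 2 u -> star (star u) = u.
Proof.
move=> u2; apply/eqP; rewrite -subr_eq0; apply/eqP.
apply: (homog2_ind (L := fun a => star (star a) - a)) u2 => [a b|c a|i j ij].
- by rewrite !starD opprD addrACA.
- by rewrite !starZ scalerBr.
- have /(all_iota_ord 8 (fun i => all _ _))/(_ i) := fstarstar_ok.
  move/(all_iota_ord 8 (fun j => _ ==> _))/(_ j)/implyP/(_ ij)/eqP.
  (* The forms here have constant coefficients, so any values of the variables will do. *)
  move/(fevalE (fun _ => 0 : K)); rewrite !feval_star feval_pair => ->.
  exact: subrr.
Qed.

(** The operator sending u to *(Phi /\ u) is 3 on the 7-dimensional and -1 on the 21-dimensional
    component, so both sides are 4 times the projection. By linearity the check on each e^{ij} in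
    [fproj27_ok] suffices. *)
Lemma proj27E (K : comNzRingType) (v : nat -> K) (u : ext_form K) :
  homog 2 u ->
  u + star (wedge (Phi K) u)
  = \sum_(k < 7) dotf u (feval v (fbasis27 k)) *: feval v (fbasis27 k).
Proof.
move=> u2; apply/eqP; rewrite -subr_eq0; apply/eqP.
apply: (homog2_ind (L := fun a => a + star (wedge (Phi K) a)
  - \sum_(k < 7) dotf a (feval v (fbasis27 k)) *: feval v (fbasis27 k))) u2
  => [a b|c a|i j ij].
- under eq_bigr do rewrite dotfDl scalerDl.
  by rewrite big_split wedgeDr starD [a + b + _]addrACA opprD [LHS]addrACA.
- under eq_bigr do rewrite dotfZl -scalerA.
  by rewrite -scaler_sumr wedgeZr starZ -scalerDr -scalerBr.
- have /(all_iota_ord 8 (fun i => all _ _))/(_ i) := fproj27_ok.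
  move/(all_iota_ord 8 (fun j => _ ==> _))/(_ j)/implyP/(_ ij)/eqP.
  move/(fevalE v); rewrite fevalD feval_star feval_wedge feval_Phi feval_sum.
  rewrite feval_pair => ->; apply/eqP; rewrite subr_eq0; apply/eqP.
  by apply: eq_bigr => k _; rewrite feval_smul peval_dot feval_pair.
Qed.

(* The variable [4 * i + a] stands for the derivative of f^{4+a} along x^i. *)
Definition fG : mform :=
  fsum 4 (fun i => fsum 4 (fun a =>
    fsmul (pvar (4 * i + a)) (fwedge (fcov i) (fcov (4 + a))))).

(** Normalizing after each factor keeps the lists short. *)
Definition fGpow (n : nat) : mform :=
  iter n (fun l => fcollect (fwedge fG l)) fone.

(** The matrix of id + G^sharp, with entry (i, j) equal to delta_ij + G(e_j, e_i) as in [sharp2].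
    Normalizing turns a vanishing entry into the empty list, which [pdet] skips. *)
Definition pentries : seq (seq zpoly) :=
  mkseq (fun i => mkseq (fun j =>
    pcollect (pconst (if i == j then Z.pos 1 else Z0)
              ++ fdot (finterior i (finterior j fG)) fone)) 8) 8.

Definition pentry (i j : nat) : zpoly := nth [::] (nth [::] pentries i) j.

Definition psqr (p : zpoly) : zpoly := pcollect (pmul p p).

(* 24 times the scalar to be squared; similarly, [pcoord27] is scaled by 6,
   whence the factor 576 = 24 ^ 2 in [key_identity]. *)
Definition pscalar : zpoly :=
  pconst (Z.pos 24)
  ++ lscale (Z.neg 12) (fdot (fGpow 2) fPhi)
  ++ fdot (fstar (fGpow 4)) fone.

Definition pcoord27 (j : nat) : zpoly :=
  fdot (lscale (Z.pos 6) fG ++ fopp (fstar (fGpow 3))) (fbasis27 j).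

Definition pcoord47 (j : nat) : zpoly := fdot (fGpow 2) (fbasis47 j).

(** The theorem for F = iG, multiplied by 576. Here F^2 = -G^2, F^3 = -iG^3 and F^4 = G^4 give the
    signs. The weights are 16 = 576 * 4 / (4 * 6^2) and 144 = 576 * 2 / 8, where the divisors 4 and
    8 are the squared norms of the basis forms and 6 is the scaling of [pcoord27]. *)
Lemma key_identity :
  pcollect (psqr pscalar
            ++ lscale (Z.pos 16) (psum 7 (fun j => psqr (pcoord27 j)))
            ++ lscale (Z.pos 144) (psum 7 (fun j => psqr (pcoord47 j))))
  = pcollect (lscale (Z.pos 576) (pdet 8 pentry)).
Proof. by apply/eqP; vm_compute. Qed.


(** * The projections and the complex identity *)

Local Open Scope classical_set_scope.
Local Open Scope complex_scope.
Local Open Scope ring_scope.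

Section OrthogonalProjection.
Variable R : realType.
Implicit Types (U : set (ext_form R)) (w : ext_form R).

(** The proposed sum has the same inner product with each b_j as w, so the difference is orthogonal
    to the span; [orthprojE] gives uniqueness. *)
Lemma orthproj_span n (b : 'I_n -> ext_form R) (N : R) U w :
  N != 0 -> (forall i j, dotf (b i) (b j) = N * (i == j)%:R) ->
  (forall u, U u <-> exists c : 'I_n -> R, u = \sum_i c i *: b i) ->
  orthproj U w = \sum_i (dotf w (b i) / N) *: b i.
Proof.
move=> N0 bE UE.
have dot_sum (c : 'I_n -> R) j : dotf (\sum_i c i *: b i) (b j) = c j * N.
  rewrite dotf_suml (bigD1 j) //= big1 => [|i /negPf ij].
    by rewrite dotfZl bE eqxx mulr1 addr0.
  by rewrite dotfZl bE ij !mulr0.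
apply: orthprojE => [u1 u2 /UE[c1 ->] /UE[c2 ->]|].
  apply/UE; exists (fun i => c1 i - c2 i).
  by rewrite -sumrB; apply: eq_bigr => i _; rewrite scalerBl.
split=> [|u /UE[c ->]]; first by apply/UE; eexists.
rewrite dotf_sumr big1 // => j _; rewrite dotfZr.
rewrite dotfDl -scaleN1r dotfZl dot_sum.
by rewrite divfK // mulN1r subrr mulr0.
Qed.

(** The real and imaginary parts of zw are real multiples of w, so both project to multiples of the
    same p, and the squared modulus of z factors out. *)
Lemma normsq_orthprojC_span n (b : 'I_n -> ext_form R) (N : R) U
    (z : R[i]) w :
  N != 0 -> (forall i j, dotf (b i) (b j) = N * (i == j)%:R) ->
  (forall u, U u <-> exists c : 'I_n -> R, u = \sum_i c i *: b i) ->
  normsq (orthprojC U (z *: toC w))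
  = (complex.Re z ^+ 2 + complex.Im z ^+ 2) * (\sum_i dotf w (b i) ^+ 2 / N).
Proof.
move=> N0 bE UE; have projE := orthproj_span _ N0 bE UE.
pose p := \sum_i (dotf w (b i) / N) *: b i.
have projZ (c : R) : orthproj U (c *: w) = c *: p.
  rewrite projE scaler_sumr; apply: eq_bigr => i _.
  by rewrite dotfZl scalerA mulrA.
have ppE : dotf p p = \sum_i dotf w (b i) ^+ 2 / N.
  rewrite dotf_suml; apply: eq_bigr => i _.
  rewrite dotfZl dotf_sumr (bigD1 i) //= big1 => [|j /negPf ji].
    by rewrite dotfZr bE eqxx mulr1 addr0 divfK // mulrAC -expr2.
  by rewrite dotfZr bE eq_sym ji !mulr0.
rewrite /orthprojC (_ : reform (_ *: toC w) = complex.Re z *: w); last first.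
  by apply/ffunP => I; rewrite !ffunE; case: (z) => a b' /=; simpc.
rewrite (_ : imform (_ *: toC w) = complex.Im z *: w); last first.
  by apply/ffunP => I; rewrite !ffunE; case: (z) => a b' /=; simpc.
rewrite !projZ /normsq; set q := toC _ + _.
have -> : reform q = complex.Re z *: p.
  by apply/ffunP => I; rewrite !ffunE /=; simpc.
have -> : imform q = complex.Im z *: p.
  by apply/ffunP => I; rewrite !ffunE /=; simpc.
by rewrite !dotfZl !dotfZr ppE; ring.
Qed.

End OrthogonalProjection.

(** * Norms of the two projections in coordinates *)

Section Spans.
Variables (R : realType) (v : nat -> R).

(** Applying the star to Phi /\ u = 3 *u gives *(Phi /\ u) = 3u by [starK2], so [proj27E] expresses
    4u in the basis. Conversely the defining conditions are linear and hold for each basis form. *)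
Lemma Lambda27_span (u : ext_form R) :
  @Lambda27 R u <->
  exists c : 'I_7 -> R, u = \sum_i c i *: feval v (fbasis27 i).
Proof.
split=> [[u2 uE]|[c ->]].
  exists (fun i => 4^-1 * dotf u (feval v (fbasis27 i))).
  under eq_bigr do rewrite -scalerA.
  rewrite -scaler_sumr -(proj27E v u2) uE starZ starK2 //.
  rewrite -[X in X + _ *: _]scale1r -scalerDl scalerA mulVf ?scale1r //.
split=> [I I2|].
  rewrite sum_ffunE big1 // => i _; rewrite ffunE fbasis27_homog //.
  exact: scaler0.
rewrite wedge_sumr star_sum scaler_sumr; apply: eq_bigr => i _.
by rewrite wedgeZr fbasis27_eigen starZ !scalerA mulrC.
Qed.

Lemma feval_basis47 (i : 'I_7) :
  feval v (fbasis47 i)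
  = wedge (cov R ord0)
          (Defs.interior (sharp1 (cov R (lift ord0 i))) (star7phi R))
    - wedge (cov R (lift ord0 i)) (phi R).
Proof.
rewrite feval_collect fevalD feval_opp !feval_wedge feval_phi.
have -> : i.+1 = lift ord0 i by [].
by rewrite (feval_cov v ord0) feval_cov feval_interior feval_star7phi.
Qed.

Lemma Lambda47_span (u : ext_form R) :
  @Lambda47 R u <->
  exists c : 'I_7 -> R, u = \sum_i c i *: feval v (fbasis47 i).
Proof.
suff E (c : 'I_7 -> R) : let al := \sum_j c j *: cov R (lift ord0 j) in
    wedge (cov R ord0) (Defs.interior (sharp1 al) (star7phi R))
    - wedge al (phi R) = \sum_i c i *: feval v (fbasis47 i).
  by split=> -[c ->]; exists c; [exact: E | exact/esym/E].
rewrite /= interior_sharp_suml wedge_sumr wedge_suml -sumrB.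
apply: eq_bigr => i _.
by rewrite feval_basis47 interior_sharpZl wedgeZr wedgeZl scalerBr.
Qed.

(** The unit z absorbs the power of i carried by the curvature: it is i here and -1 in
    [normsq_pi47]. *)
Lemma normsq_pi27 (z : R[i]) (w : ext_form R) :
  complex.Re z ^+ 2 + complex.Im z ^+ 2 = 1 ->
  normsq (pi27 (z *: toC w))
  = 4^-1 * \sum_(i < 7) dotf w (feval v (fbasis27 i)) ^+ 2.
Proof.
move=> z1; have := @normsq_orthprojC_span R 7 (fun i => feval v (fbasis27 i)) 4
  (@Lambda27 R) z w.
rewrite pnatr_eq0 z1 mul1r -mulr_suml [_ / 4]mulrC => -> //.
  by move=> i j; apply: gramP fbasis27_gram.
exact: Lambda27_span.
Qed.

Lemma normsq_pi47 (z : R[i]) (w : ext_form R) :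
  complex.Re z ^+ 2 + complex.Im z ^+ 2 = 1 ->
  normsq (pi47 (z *: toC w))
  = 8^-1 * \sum_(i < 7) dotf w (feval v (fbasis47 i)) ^+ 2.
Proof.
move=> z1; have := @normsq_orthprojC_span R 7 (fun i => feval v (fbasis47 i)) 8
  (@Lambda47 R) z w.
rewrite pnatr_eq0 z1 mul1r -mulr_suml [_ / 8]mulrC => -> //.
  by move=> i j; apply: gramP fbasis47_gram.
exact: Lambda47_span.
Qed.

End Spans.

(** * Passage from real to complex coefficients *)

Section Complexification.
Variables (R : realType) (v : nat -> R).

Let vC k := (v k)%:C.

Lemma zvalC c : zval R[i] c = (zval R c)%:C.
Proof. by rewrite /zval rmorph_int. Qed.

Lemma mevalC x : meval vC x = (meval v x)%:C.
Proof. by rewrite /meval rmorph_prod. Qed.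

(** The coefficients are integers and the variables take real values, so evaluation commutes with
    the embedding of R in R[i]. *)
Lemma fevalC l : feval vC l = toC (feval v l).
Proof.
apply/ffunP => I; rewrite ffunE /feval /lcomb !sum_ffunE rmorph_sum.
apply: eq_bigr => t _; rewrite !ffunE /GRing.scale /= zvalC mevalC.
by rewrite !rmorphM rmorph_nat.
Qed.

Lemma Phi_toC : Phi R[i] = toC (Phi R).
Proof. by rewrite -(feval_Phi vC) fevalC feval_Phi. Qed.

Lemma star_toC (w : ext_form R) : star (toC w) = toC (star w).
Proof.
by apply/ffunP => I; rewrite !ffunE rmorphM rmorphXn rmorphN1.
Qed.

Lemma dotf_toC (a b : ext_form R) : dotf (toC a) (toC b) = (dotf a b)%:C.
Proof.
by rewrite /dotf rmorph_sum; apply: eq_bigr => I _; rewrite !ffunE rmorphM.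
Qed.

End Complexification.

(** * From the polynomial identity to the curvature *)

Section Identity.
Variable R : realType.

Section Matrix.
Variable v : nat -> R.

Lemma pentryE (i j : 'I_8) :
  peval v (pentry i j) = (1%:M + sharp2 (feval v fG)) i j.
Proof.
rewrite /pentry !nth_mkseq // peval_collect pevalD peval_const !mxE /eval2.
congr (_ + _); first by rewrite -(inj_eq val_inj) /=; case: eqP.
(* Basis vectors are metric duals of the e^k, the shape that [feval_interior] expects. *)
have deltaE k : delta_mx k 0 = sharp1 (cov R k).
  by apply/colP => l; rewrite !mxE ffunE andbT (inj_eq finset.set1_inj).
by rewrite !deltaE -!feval_interior scal_feval.
Qed.

Lemma det_pentry :
  peval v (pdet 8 pentry) = \det (1%:M + sharp2 (feval v fG)).
Proof.
by rewrite pdetE; congr (\det _); apply/matrixP => i j; rewrite mxE pentryE.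
Qed.

Lemma psqrE p : peval v (psqr p) = peval v p ^+ 2.
Proof. by rewrite peval_collect pevalM. Qed.

Lemma real_identity :
  (24 - 12 * dotf (feval v (fGpow 2)) (Phi R)
      + scal (star (feval v (fGpow 4)))) ^+ 2
  + 16 * (\sum_(j < 7) dotf (6 *: feval v fG - star (feval v (fGpow 3)))
                            (feval v (fbasis27 j)) ^+ 2)
  + 144 * (\sum_(j < 7) dotf (feval v (fGpow 2)) (feval v (fbasis47 j)) ^+ 2)
  = 576 * \det (1%:M + sharp2 (feval v fG)).
Proof.
(* Stated for arbitrary polynomials, so that the rewriting does not unfold the large concrete
   ones. *)
have eval_squares (s d : zpoly) (p q : nat -> zpoly) (c e g : Z) :
    pcollect (psqr s ++ lscale c (psum 7 (fun j => psqr (p j)))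
              ++ lscale e (psum 7 (fun j => psqr (q j))))
    = pcollect (lscale g d) ->
    peval v s ^+ 2 + zval R c * (\sum_(j < 7) peval v (p j) ^+ 2)
      + zval R e * (\sum_(j < 7) peval v (q j) ^+ 2) = zval R g * peval v d.
  move/(pevalE v); rewrite pevalZ !pevalD !pevalZ !peval_sum psqrE addrA => <-.
  by congr (_ + _ * _ + _ * _); apply: eq_bigr => j _; rewrite psqrE.
have := eval_squares _ _ _ _ _ _ _ key_identity.
rewrite det_pentry => {eval_squares} <-; congr (_ ^+ 2 + _ * _ + _ * _).
- rewrite /pscalar pevalD peval_const pevalD pevalZ addrA; congr (_ + _).
    by rewrite peval_dot feval_Phi -mulNr.
  by rewrite -feval_star scal_feval.
- have eval_coord l1 l2 l :
      peval v (fdot (lscale (Z.pos 6) l1 ++ fopp (fstar l2)) l)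
      = dotf (6 *: feval v l1 - star (feval v l2)) (feval v l).
    by rewrite peval_dot fevalD feval_opp fevalZ feval_star.
  by apply: eq_bigr => j _; rewrite -eval_coord.
- by apply: eq_bigr => j _; rewrite /pcoord47 peval_dot.
Qed.

End Matrix.

(** Assigns values to the variables of [fG]: division of k = 4i + a by 4 recovers i and a. *)
Definition jacobian (f : 'rV[R]_4 -> torus R) (x : 'rV[R]_4) (k : nat) : R :=
  partial f (inord (k %% 4)) (inord (k %/ 4)) x.

Lemma curvatureE (f : 'rV[R]_4 -> torus R) x y :
  curvature f (x, y) = 'i%C *: toC (feval (jacobian f x) fG).
Proof.
rewrite -fevalC /curvature; congr (_ *: _).
rewrite feval_sum; apply: eq_bigr => i _.
rewrite feval_sum; apply: eq_bigr => a _.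
rewrite feval_smul peval_var feval_wedge /jacobian.
have -> : ((4 * i + a) %% 4 = a)%N by rewrite mulnC modnMDl modn_small.
have -> : ((4 * i + a) %/ 4 = i)%N.
  by rewrite mulnC divnMDl // divn_small ?addn0.
rewrite !inord_val; congr (_ *: wedge _ _); apply/esym.
  exact: (feval_cov _ (lshift 4 i)).
exact: (feval_cov _ (rshift 4 a)).
Qed.

Lemma wpow_curvature (f : 'rV[R]_4 -> torus R) x y n :
  wpow (curvature f (x, y)) n
  = 'i%C ^+ n *: toC (feval (jacobian f x) (fGpow n)).
Proof.
rewrite -fevalC; elim: n => [|n IHn]; first by rewrite scale1r feval_one.
rewrite [LHS]/= -/(wpow _ n) IHn curvatureE -fevalC wedgeZl wedgeZr scalerA.
by rewrite -exprS -feval_wedge; congr (_ *: _); exact/esym/feval_collect.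
Qed.

(** Division by 576 = 24^2, followed by the embedding in R[i]. Here p is <G^2, Phi>, q is *G^4, and
    S and T are the sums of squares in [real_identity]. *)
Lemma normalized_identity (p q n m S T d : R) :
  n = 4^-1 * (6^-1 ^+ 2 * S) -> m = 8^-1 * T ->
  (24 - 12 * p + q) ^+ 2 + 16 * S + 144 * T = 576 * d ->
  (1 + 2^-1 * - p%:C + 24^-1 * q%:C) ^+ 2 + (4 * n)%:C + (2 * m)%:C = d%:C.
Proof.
move=> -> -> key; have -> : d = (1 - 2^-1 * p + 24^-1 * q) ^+ 2
    + 4 * (4^-1 * (6^-1 ^+ 2 * S)) + 2 * (8^-1 * T) by lra.
rewrite !rmorphD rmorphXn rmorphD rmorphB !rmorphM.
by rewrite !fmorphV !rmorph_nat rmorph1 mulrN.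
Qed.

(** The powers of G are replaced by arbitrary forms, since only the bookkeeping of i and of the
    normalizing constants remains. *)
Lemma complex_identity (v : nat -> R) (G G2 G3 G4 : ext_form R) :
  (24 - 12 * dotf G2 (Phi R) + scal (star G4)) ^+ 2
  + 16 * (\sum_(j < 7) dotf (6 *: G - star G3) (feval v (fbasis27 j)) ^+ 2)
  + 144 * (\sum_(j < 7) dotf G2 (feval v (fbasis47 j)) ^+ 2)
  = 576 * \det (1%:M + sharp2 G) ->
  (1 + 2^-1 * dotf ('i%C ^+ 2 *: toC G2) (Phi R[i])
     + 24^-1 * scal (star ('i%C ^+ 4 *: toC G4))) ^+ 2
  + (4 * normsq (pi27 ('i%C *: toC G
                       + 6^-1 *: star ('i%C ^+ 3 *: toC G3))))%:C
  + (2 * normsq (pi47 ('i%C ^+ 2 *: toC G2)))%:C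
  = (\det (1%:M + sharp2 (reform (- 'i%C *: ('i%C *: toC G)))))%:C.
Proof.
move=> key.
have i2 : 'i%C ^+ 2 = -1 :> R[i] by apply/eqP; rewrite eq_complex /=; simpc.
have i3 : 'i%C ^+ 3 = - 'i%C :> R[i] by rewrite exprS i2 mulrN1.
have i4 : 'i%C ^+ 4 = 1 :> R[i] by rewrite (exprM _ 2 2) i2 sqrrN expr1n.
rewrite i2 i3 i4 {i2 i3 i4}.
(* The form -i(iG) = G is already real, so taking real parts loses nothing. *)
have -> : reform (- 'i%C *: ('i%C *: toC G)) = G.
  by apply/ffunP => I; rewrite !ffunE /=; simpc.
rewrite (Phi_toC v) dotfZl dotf_toC scale1r !starZ !star_toC mulN1r.
have -> : scal (toC (star G4)) = (scal (star G4))%:C by rewrite /scal ffunE.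
move: (star G3) (star G4) key => H3 H4 key.
(* Factoring out i/6 exhibits a unit times a real form, as [normsq_pi27] requires, with the integral
   combination of [real_identity] inside. *)
have -> : 'i%C *: toC G + 6^-1 *: (- 'i%C *: toC H3)
          = 'i%C *: toC (6^-1 *: (6 *: G - H3)).
  have scalarE (p q : R) : 'i%C * p%:C + 6^-1 * (- 'i%C * q%:C)
      = 'i%C * (6^-1 * (6 * p - q))%:C.
    by rewrite rmorphM rmorphB rmorphM fmorphV !rmorph_nat; field.
  by apply/ffunP => I; rewrite !ffunE; exact: scalarE.
apply: (normalized_identity _ _ key).
  rewrite (normsq_pi27 v); last by rewrite /= expr0n expr1n add0r.
  under eq_bigr do rewrite dotfZl exprMn.
  by rewrite -mulr_sumr.
by rewrite (normsq_pi47 v) //= oppr0 expr0n sqrrN expr1n addr0.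
Qed.

End Identity.

Theorem lemma5p5 (R : realType) (B : set 'rV[R]_4) (f : 'rV[R]_4 -> torus R)
    (oB : open B) (smooth_f : smooth_torus_map B f)
    (x : 'rV[R]_4) (y : torus R) (Bx : B x) :
  let F : ext_form R[i] := curvature f (x, y) in
  (1 + 2^-1 * dotf (wpow F 2) (Phi R[i]) + 24^-1 * scal (star (wpow F 4))) ^+ 2
  + (4 * normsq (pi27 (F + 6^-1 *: star (wpow F 3))))%:C
  + (2 * normsq (pi47 (wpow F 2)))%:C
  = (\det (1%:M + sharp2 (reform (- 'i%C *: F))))%:C.
Proof.
move=> F; rewrite /F !wpow_curvature curvatureE.
(* What remains is algebraic in the partial derivatives at x: the polynomial identity at the values
   [jacobian f x]. *)
exact/complex_identity/real_identity.
Qed.
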